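(* Let $\bm{x_0}\in\mathbb{R}^N$ be a non-negative monotone signal: with the convention $\bm{x_0}(0)=0$, one has $\bm{x_0}(i)\ge\bm{x_0}(i-1)$ for all $i\in\{1,\ldots,N\}$. Let $\Omega=\{i\in\{1,\ldots,N\}:\bm{x_0}(i)>\bm{x_0}(i-1)\}$, assume $\Omega\neq\emptyset$, let $\Omega^c=\{1,\ldots,N\}\setminus\Omega$, and let $i_k$ denote the last (largest) element of $\Omega$. Let $G$ be the $N\times N$ matrix with entries $[G]_{ij}=1_{\{i=j\}}-1_{\{i=j+1\}}$. Given $\bm{g}\in\mathbb{R}^N$, consider the quadratic program in the variables $\bm{w}\in\mathbb{R}^N$ and $\tau\in\mathbb{R}$: $$\underset{\bm{w},\tau}{\text{minimize}}\ \|\bm{g}-G^{\top}\bm{w}\|^2\quad\text{subject to}\quad \tau\ge0,\quad \bm{w}(j)=\tau\ \ (j\in\Omega),\quad \bm{w}(j)\le\tau\ \ (j\in\Omega^c).$$ Then the optimal value $\tau^*$ of the variable $\tau$ (that is, the $\tau$-component of an optimal solution $(\bm{w}^*,\tau^* )$) is given by $$\tau^{*}=\max\left(\max_{j=i_k,\ldots,N}\left\{\sum_{n=j}^{N}\bm{g}(n)\right\},\,0\right).$$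
   Context: $\|\cdot\|$ is the Euclidean norm on $\mathbb{R}^N$, $1_{\{\cdot\}}$ is the indicator of a condition, and the $i$-th entry of a vector $\bm{x}$ is written $\bm{x}(i)$. *)

(* Defs.v *)
From HB Require Import structures.
From mathcomp Require Import all_boot all_order all_algebra.
From mathcomp Require Import reals.

Set Implicit Arguments.
Unset Strict Implicit.
Unset Printing Implicit Defensive.

Import Order.TTheory GRing.Theory Num.Theory.
Local Open Scope ring_scope.

(* The index i : 'I_N stands for the 1-based index i + 1 of {1, ..., N}. *)

Section Defs.
Variables (R : realType) (N : nat).
Implicit Types (x g w : 'cV[R]_N) (i j : 'I_N) (tau : R).

(* Not the library norm on matrices, which is the sup norm. *)
Definition enorm x : R := Num.sqrt (\sum_i x i 0 ^+ 2).

(* The entry x(i-1), with the convention x(0) = 0; [ord_pred] is cyclic, hence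
   the separate treatment of the first index. *)
Definition prev_entry x i : R :=
  if i == 0%N :> nat then 0 else x (ord_pred i) 0.

Definition monotone_signal x : Prop := forall i, prev_entry x i <= x i 0.

Definition jumps x : {set 'I_N} := [set i | prev_entry x i < x i 0].

Definition diff_mx : 'M[R]_N :=
  \matrix_(i, j) ((i == j)%:R - (i == j.+1 :> nat)%:R).

Definition objective g w : R := enorm (g - diff_mx^T *m w) ^+ 2.

Definition feasible (Omega : {set 'I_N}) w tau : Prop :=
  [/\ 0 <= tau,
      forall j, j \in Omega -> w j 0 = tau
    & forall j, j \in ~: Omega -> w j 0 <= tau].

Definition optimal (Omega : {set 'I_N}) g w tau : Prop :=
  feasible Omega w tau /\
  forall w' tau', feasible Omega w' tau' -> objective g w <= objective g w'.

Definition is_last (Omega : {set 'I_N}) i : Prop :=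
  i \in Omega /\ forall j, j \in Omega -> (j <= i)%N.

Definition tail_sum g j : R := \sum_(n < N | (j <= n)%N) g n 0.

(* The maximum of the tail sums over j >= k. The seed of the iterated maximum
   is the term j = k, so that no value foreign to the family enters. *)
Definition max_tail_sum g k : R :=
  \big[Num.max/tail_sum g k]_(j < N | (k <= j)%N) tail_sum g j.

End Defs.

Arguments diff_mx {R N}.

(* Main.v *)
Require Import Defs.
From HB Require Import structures.
From mathcomp Require Import all_boot all_order all_algebra.
From mathcomp Require Import reals.
From mathcomp Require Import boolp classical_sets topology normedtype derive.
(* finset comes after classical_sets, so that set0 is the empty finite set. *)
From mathcomp Require Import finset ring lra.

Set Implicit Arguments.
Unset Strict Implicit.
Unset Printing Implicit Defensive.

Import Order.TTheory GRing.Theory Num.Theory.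
Import numFieldTopology.Exports numFieldNormedType.Exports.
Local Open Scope ring_scope.

(** Write r = g - G^T w for the residual and S_j for the sum of g over the
indices n >= j. Two facts about G drive everything. Since (G^T w)(n) is
w(n) - w(n+1), with w(N+1) = 0, the tail sums of G^T w telescope to the entries
of w, so the tail sum of r from j is S_j - w(j) ([tail_sum_residual]). And G^T
maps the indicator of {1, ..., k} to the k-th basis vector, so adding e to the
first k entries of w changes the objective by e^2 - 2 e r(k)
([objective_shift]).

Let (w, tau) be optimal. The value of tau is read off from two kinds of such
shifts, always at some k >= i_k so that all of Omega is moved together with tau.

- Raising tau and w(1), ..., w(k) together is always feasible; optimality gives
  r(k) <= 0 for k >= i_k ([optimal_residual_le0]). Summing over n >= j,
  S_j <= w(j) <= tau for every j >= i_k, so tau is at least the claimed maximum.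

- Suppose tau > 0 and let k be the largest index with w(k) = tau; k >= i_k since
  w(i_k) = tau. For n >= k, lowering tau and w(1), ..., w(n) together by a small
  amount is feasible, because the entries beyond n are strictly below tau. Hence
  r(n) = 0 for all n >= k ([optimal_residual_eq0]), and tau = w(k) = S_k is one
  of the terms of the maximum.

An optimum exists because a w that does at least as well as 0 has bounded
residual, hence bounded G^T w, hence bounded entries, which are tail sums of
G^T w; the problem thus reduces to minimizing a continuous function over a
compact set ([optimal_exists]). *)

(** * The difference operator and the residual *)

Section Residual.
Variables (R : realType) (N : nat).
Implicit Types (g w u : 'cV[R]_N) (i j k n : 'I_N) (tau e : R).

Definition residual g w : 'cV[R]_N := g - diff_mx^T *m w.

Definition prefix_ind k : 'cV[R]_N := \col_i (i <= k)%:R.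

Lemma objectiveE g w : objective g w = \sum_n residual g w n 0 ^+ 2.
Proof. by rewrite /objective sqr_sqrtr// sumr_ge0// => i _; rewrite sqr_ge0. Qed.

(** Telescoping. The sum is computed after exchanging it with the matrix product:
the n >= j with n = i, minus those with n + 1 = i, contribute
1_{j <= i} - 1_{j < i} to the coefficient of w(i). *)
Lemma tail_sum_trdiff w j : tail_sum (diff_mx^T *m w) j = w j 0.
Proof.
have diag i : \sum_(n < N | (j <= n)%N) (i == n)%:R = (j <= i)%:R :> R.
  rewrite big_mkcond (bigD1 i)//= eqxx big1 ?addr0; first by case: leqP.
  by move=> n /negPf; rewrite eq_sym => ->; rewrite if_same.
have subdiag i :
    \sum_(n < N | (j <= n)%N) (i == n.+1 :> nat)%:R = (j < i)%:R :> R.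
  have [->|i0] := posnP i.
    by rewrite big1.
  have lt_iN : (i.-1 < N)%N by rewrite (leq_ltn_trans (leq_pred i)).
  rewrite big_mkcond (bigD1 (Ordinal lt_iN))//= prednK// eqxx big1 ?addr0.
    by rewrite -ltnS prednK//; case: ltnP.
  move=> n /eqP nNi; case: eqP; rewrite ?if_same // => ei.
  by case: nNi; apply: val_inj; rewrite /= ei.
rewrite /tail_sum; under eq_bigr do rewrite mxE.
rewrite exchange_big /= (bigD1 j)//= [X in _ + X]big1 ?addr0.
  under eq_bigr do rewrite !mxE.
  by rewrite -mulr_suml sumrB diag subdiag leqnn ltnn subr0 mul1r.
move=> i iNj; under eq_bigr do rewrite !mxE.
by rewrite -mulr_suml sumrB diag subdiag leq_eqVlt val_eqE eq_sym (negPf iNj)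
  /= subrr mul0r.
Qed.

Lemma tail_sumB g u j : tail_sum (g - u) j = tail_sum g j - tail_sum u j.
Proof. by rewrite -sumrB; apply: eq_bigr => n _; rewrite !mxE. Qed.

Lemma tail_sum_residual g w j : tail_sum (residual g w) j = tail_sum g j - w j 0.
Proof. by rewrite tail_sumB tail_sum_trdiff. Qed.

(** The indicator of an initial segment drops only at its end, so its differences
vanish except there. *)
Lemma trdiff_prefix_ind k : diff_mx^T *m prefix_ind k = delta_mx k 0.
Proof.
apply/colP => n; rewrite !mxE eqxx andbT.
under eq_bigr do rewrite !mxE mulrBl.
rewrite sumrB (bigD1 n)//= eqxx mul1r big1 ?addr0; last first.
  by move=> i /negPf ->; rewrite mul0r.
have -> : \sum_(i < N) (i == n.+1 :> nat)%:R * (i <= k)%:R = (n < k)%:R :> R.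
  have [nN|] := ltnP n.+1 N.
    rewrite (bigD1 (Ordinal nN))//= eqxx mul1r big1 ?addr0// => i /eqP iNn.
    case: eqP => [ei|]; last by rewrite mul0r.
    by case: iNn; apply: val_inj.
  move=> Nn; rewrite big1.
    by rewrite ltnNge -ltnS (leq_trans (ltn_ord k) Nn).
  by move=> i _; rewrite (ltn_eqF (leq_trans (ltn_ord i) Nn)) mul0r.
by rewrite leq_eqVlt val_eqE; case: eqP => [->|_] /=; rewrite ?ltnn ?subr0 ?subrr.
Qed.

(** Only the k-th entry of the residual sees the shift: one coordinate of the
residual at a time can be tested for optimality. *)
Lemma objective_shift g w k e :
  objective g (w + e *: prefix_ind k) =
  objective g w - 2 * e * residual g w k 0 + e ^+ 2.
Proof.
rewrite !objectiveE (bigD1 k)//= [in RHS](bigD1 k)//=.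
have re n : residual g (w + e *: prefix_ind k) n 0 =
            residual g w n 0 - e * (n == k)%:R.
  rewrite /residual mulmxDr -scalemxAr trdiff_prefix_ind !mxE eqxx andbT.
  by rewrite opprD addrA.
rewrite re eqxx; under eq_bigr => n nk do rewrite re (negPf nk) mulr0 subr0.
by rewrite mulr1n; ring.
Qed.

End Residual.

(** * The value of tau at an optimum *)

Section Optimality.
Variables (R : realType) (N : nat) (Omega : {set 'I_N}) (g : 'cV[R]_N).
Variables (ik : 'I_N) (w : 'cV[R]_N) (tau : R).
Hypothesis ik_last : is_last Omega ik.
Hypothesis w_opt : optimal Omega g w tau.

(** Raising tau together with the entries up to k preserves feasibility for every
amount, since Omega lies below k; if r(k) were positive, raising by exactly
r(k), the minimizer of e^2 - 2 e r(k), would lower the objective. *)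
Lemma optimal_residual_le0 (k : 'I_N) : (ik <= k)%N -> residual g w k 0 <= 0.
Proof.
move=> le_ik; rewrite leNgt; apply/negP => r_gt0.
set r := residual g w k 0 in r_gt0.
case: w_opt => -[tau0 wO wC] /(_ (w + r *: prefix_ind R k)).
move=> /(_ (tau + r)); rewrite objective_shift -/r.
have feas : feasible Omega (w + r *: prefix_ind R k) (tau + r).
  split=> [|j jO|j jO]; first by rewrite addr_ge0// ltW.
    by rewrite !mxE wO// (leq_trans (ik_last.2 j jO) le_ik) mulr1.
  rewrite !mxE lerD ?wC//.
  by case: (j <= k)%N; [rewrite mulr1|rewrite mulr0 ltW].
by move=> /(_ feas); nra.
Qed.

(** When the entries beyond k and the constraint tau >= 0 all have slack, the
shift used for [optimal_residual_le0] may also be made, by a small amount,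
downwards, which rules out r(k) < 0. *)
Lemma optimal_residual_eq0 (k : 'I_N) : (ik <= k)%N -> 0 < tau ->
  (forall i : 'I_N, (k < i)%N -> w i 0 < tau) -> residual g w k 0 = 0.
Proof.
move=> le_ik tau0 slack; apply/le_anti; rewrite optimal_residual_le0//=.
rewrite leNgt; apply/negP => r_lt0.
case: w_opt => -[_ wO wC] opt.
(* The shift by t stays feasible for t <= t0, and lowers the objective for
   0 < t < - 2 r(k). *)
pose t0 := \big[Num.min/tau]_(i < N | (k < i)%N) (tau - w i 0).
have t0_gt0 : 0 < t0.
  by apply: lt_bigmin => // i ki; rewrite subr_gt0 slack.
pose t := Num.min t0 (- residual g w k 0).
have t_gt0 : 0 < t by rewrite lt_min t0_gt0 oppr_gt0.
have t_le : t <= t0 by rewrite ge_min lexx.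
have t_ler : t <= - residual g w k 0 by rewrite ge_min lexx orbT.
have feas : feasible Omega (w + (- t) *: prefix_ind R k) (tau - t).
  split=> [|j jO|j jO].
  - by rewrite subr_ge0 (le_trans t_le)// bigmin_le_id.
  - by rewrite !mxE wO// (leq_trans (ik_last.2 j jO) le_ik) mulr1.
  rewrite !mxE; case: leqP => [_|kj]; first by rewrite mulr1 lerD ?wC.
  rewrite mulr0 addr0 lerBrDr -lerBrDl (le_trans t_le)//.
  exact: bigmin_le_cond.
by have := opt _ _ feas; rewrite objective_shift; nra.
Qed.

Lemma optimal_tauE : tau = Num.max (max_tail_sum g ik) 0.
Proof.
have [[tau0 wO wC] _] := w_opt.
have w_le j : w j 0 <= tau.
  by have [/wO->//|jO] := boolP (j \in Omega); rewrite wC// inE.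
have tail_le (j : 'I_N) : (ik <= j)%N -> tail_sum g j <= tau.
  move=> ikj; apply: le_trans (w_le j); rewrite -subr_le0 -tail_sum_residual.
  by apply: sumr_le0 => n jn; rewrite optimal_residual_le0// (leq_trans ikj).
apply/le_anti/andP; split; last by rewrite ge_max tau0 bigmax_le ?tail_le.
rewrite le_max; have [->|tauN0] := eqVneq tau 0; first by rewrite lexx orbT.
have tau_gt0 : 0 < tau by rewrite lt_def tauN0.
have active_ik : w ik 0 == tau by rewrite wO// ik_last.1.
(* k is the last index at which the constraint w(k) <= tau is active. *)
have [k /= /eqP wk k_max] :=
  @arg_maxnP _ ik (fun i => w i 0 == tau) (@nat_of_ord N) active_ik.
have ik_k : (ik <= k)%N by exact: k_max.
have slack (i : 'I_N) : (k < i)%N -> w i 0 < tau.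
  move=> ki; rewrite lt_neqAle w_le andbT; apply/negP => /k_max /=.
  by rewrite /= leqNgt ki.
apply/orP; left; have -> : tau = tail_sum g k.
  rewrite -wk; apply/esym/eqP; rewrite -subr_eq0 -tail_sum_residual.
  apply/eqP/big1 => n kn; apply: optimal_residual_eq0 => //.
    exact: leq_trans kn.
  by move=> i ni; apply: slack; exact: leq_ltn_trans ni.
exact: le_bigmax_cond.
Qed.

End Optimality.

(** * Existence of an optimum *)

Section Existence.
Local Open Scope classical_set_scope.
Variables (R : realType) (N : nat) (Omega : {set 'I_N}) (g : 'cV[R]_N).
Variable ik : 'I_N.
Hypothesis ikO : ik \in Omega.

(** Each entry of the residual has square at most c = ||g||^2, hence absolute
value at most c + 1 (which avoids a square root); so each entry of G^T w is at
most |g(n)| + c + 1 in absolute value, and w(j) is a tail sum of these. *)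
Lemma sublevel_bound w j : objective g w <= objective g 0 ->
  `|w j 0| <= \sum_n (`|g n 0| + (objective g 0 + 1)).
Proof.
move=> le_w; rewrite -tail_sum_trdiff (le_trans (ler_norm_sum _ _ _))//.
rewrite big_mkcond ler_sum// => n _.
have obj_ge0 : 0 <= objective g 0 by rewrite sqr_ge0.
case: ifP => _; last by rewrite addr_ge0// addr_ge0.
rewrite -[X in `|X|](subKr (g n 0)) (le_trans (ler_normB _ _))// lerD2l.
have : residual g w n 0 ^+ 2 <= objective g 0.
  rewrite (le_trans _ le_w)// objectiveE (bigD1 n)//= lerDl.
  by rewrite sumr_ge0// => i _; rewrite sqr_ge0.
rewrite -real_normK ?num_real// !mxE.
by move: (normr_ge0 (g n 0 - \sum_j0 diff_mx^T n j0 * w j0 0)); nra.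
Qed.

(** The variable is transposed in the topological statements because the
compactness of boxes, [rV_compact], concerns row vectors. *)
Lemma continuous_objective_tr : continuous (fun v : 'rV[R]_N => objective g v^T).
Proof.
rewrite (_ : (fun v => _) = fun v : 'rV[R]_N =>
    \sum_n (g n 0 - \sum_i diff_mx^T n i * v 0 i) ^+ 2); last first.
  apply/funext => v; rewrite objectiveE; apply: eq_bigr => n _.
  by rewrite !mxE; under eq_bigr do rewrite [v^T _ _]mxE.
have coord_cont n :
    continuous (fun v : 'rV[R]_N => g n 0 - \sum_i diff_mx^T n i * v 0 i).
  have sum_cont : continuous (fun v : 'rV[R]_N => \sum_i diff_mx^T n i * v 0 i).
    apply: continuous_big => [|i _ v]; first exact: add_continuous.
    exact: continuousM (@cst_continuous _ _ _ v) (@coord_continuous _ _ _ 0 i v).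
  by move=> v; exact: continuousB (@cst_continuous _ _ (g n 0) v) (sum_cont v).
apply: continuous_big => [|n _ v]; first exact: add_continuous.
exact: continuousM (coord_cont n v) (coord_cont n v).
Qed.

(** As i_k is in Omega, tau is determined by w as its entry at i_k, so the
feasible set is described by w alone. *)
Lemma closed_feasible_tr :
  closed [set v : 'rV[R]_N | feasible Omega v^T (v 0 ik)].
Proof.
have closed_coordB (A : set R) i j : closed A ->
    closed [set v : 'rV[R]_N | A (v 0 i - v 0 j)].
  move=> clA; apply: (@preimage_closed _ _ (fun v : 'rV[R]_N => v 0 i - v 0 j))
    => //.
  by move=> v _; apply: continuousB; exact: coord_continuous.
rewrite [X in closed X](_ : _ = [set v : 'rV[R]_N | 0 <= v 0 ik] `&`
    \bigcap_(j in [set` Omega]) [set v | v 0 j - v 0 ik = 0] `&`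
    \bigcap_(j in [set` ~: Omega]) [set v | v 0 j - v 0 ik <= 0]);
  last first.
  apply/seteqP; split=> v.
    move=> [v0 vO vC]; split; [split=> //|] => j jO /=.
      by rewrite -(vO j jO) mxE subrr.
    by rewrite subr_le0; have := vC j jO; rewrite mxE.
  move=> [[v0 vO] vC]; split=> // j jO; rewrite mxE.
    by apply/eqP; rewrite -subr_eq0; apply/eqP/(vO j jO).
  by rewrite -subr_le0; exact: (vC j jO).
apply: closedI; first apply: closedI.
- apply: (@preimage_closed _ _ (fun v : 'rV[R]_N => v 0 ik) [set x | 0 <= x]).
    by move=> v _; exact: coord_continuous.
  exact: closed_ge.
- apply: closed_bigI => j _.
  by apply: (closed_coordB [set x | x = 0]); exact: closed_eq.
apply: closed_bigI => j _.
by apply: (closed_coordB [set x | x <= 0]); exact: closed_le.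
Qed.

(** The extreme value theorem on the feasible vectors with entries bounded as in
[sublevel_bound]; a feasible w outside this set does worse than 0, which
belongs to it. *)
Lemma optimal_exists : exists w tau, optimal Omega g w tau.
Proof.
pose B := \sum_n (`|g n 0| + (objective g 0 + 1)).
pose K := [set v : 'rV[R]_N | forall i, `[- B, B] (v ord0 i)] `&`
          [set v : 'rV[R]_N | feasible Omega v^T (v 0 ik)].
have in_K w tau : feasible Omega w tau -> objective g w <= objective g 0 ->
    K w^T.
  move=> feas le_w; split.
    by move=> i /=; rewrite mxE in_itv/= -ler_norml sublevel_bound.
  by rewrite /= trmxK mxE; case: (feas) => _ ->.
have feas0 : feasible Omega (0 : 'cV[R]_N) 0.
  by split=> // j _; rewrite mxE.
have K0 : K !=set0 by exists (0^T); exact: in_K feas0 (lexx _).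
have K_compact : compact K.
  apply: compact_closedI closed_feasible_tr.
  by apply: (@rV_compact R N (fun=> `[- B, B])) => i; exact: segment_compact.
have [v vK v_min] := EVT_min_rV K0 K_compact
  (continuous_subspaceT continuous_objective_tr).
have v_le w tau : feasible Omega w tau -> objective g w <= objective g 0 ->
    objective g v^T <= objective g w.
  by move=> fw /(in_K _ _ fw) wK; rewrite -[w]trmxK; apply/v_min/mem_set.
exists v^T, (v 0 ik); split; first by have [] := set_mem vK.
move=> w tau fw; have [le_w|lt_w] := leP (objective g w) (objective g 0).
  exact: v_le fw le_w.
by rewrite (le_trans _ (ltW lt_w))// (v_le _ _ feas0).
Qed.

End Existence.

Theorem lemma4p1 (R : realType) (N : nat) (x0 g : 'cV[R]_N) (ik : 'I_N)
    (hx0 : monotone_signal x0)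
    (hOmega : jumps x0 != set0)
    (hik : is_last (jumps x0) ik) :
  (exists (w : 'cV[R]_N) (tau : R), optimal (jumps x0) g w tau) /\
  (forall (w : 'cV[R]_N) (tau : R), optimal (jumps x0) g w tau ->
     tau = Num.max (max_tail_sum g ik) 0).
Proof.
split; first exact: optimal_exists hik.1.
by move=> w tau; exact: optimal_tauE.
Qed.
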